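(* Consider a Boolean control network (BCN) with $n$ state variables, $m$ inputs and $p$ outputs, given by logical equations $x_i(t+1)=f_i(x_1(t),\dots,x_n(t),u_1(t),\dots,u_m(t))$ $(1\le i\le n)$, $y_i(t)=h_i(x_1(t),\dots,x_n(t))$ $(1\le i\le p)$, with algebraic form $x(t+1)=Lu(t)x(t)$, $y(t)=Hx(t)$, where $L\in\mathcal{L}_{2^n\times 2^{n+m}}$, $H\in\mathcal{L}_{2^p\times 2^n}$. Write $L=[L_1,L_2,\dots,L_{2^m}]$ with $L_i\in\mathcal{L}_{2^n\times 2^n}$, and let $0\le s\le n$. Then the following statements are equivalent: (i) the BCN is decomposable with respect to outputs with order $n-s$; (ii) there exist a permutation matrix $T\in\mathcal{L}_{2^n\times 2^n}$ and logical matrices $G_1\in\mathcal{L}_{2^s\times 2^{m+s}}$ and $M\in\mathcal{L}_{2^p\times 2^s}$ such that $$(I_{2^s}\otimes \mathbf{1}_{2^{n-s}}^{\mathrm{T}})\,T\,L\,(I_{2^m}\otimes T^{\mathrm{T}})=G_1(I_{2^{m+s}}\otimes \mathbf{1}_{2^{n-s}}^{\mathrm{T}}),\qquad HT^{\mathrm{T}}=M(I_{2^s}\otimes \mathbf{1}_{2^{n-s}}^{\mathrm{T}});$$ (iii) there exist a permutation matrix $T\in\mathcal{L}_{2^n\times 2^n}$, a logical matrix $G_1=[G_{11},G_{12},\dots,G_{12^m}]\in\mathcal{L}_{2^s\times 2^{m+s}}$ with blocks $G_{1i}\in\mathcal{L}_{2^s\times 2^s}$, and $M\in\mathcal{L}_{2^p\times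 2^s}$ such that, with $Q=(I_{2^s}\otimes \mathbf{1}_{2^{n-s}}^{\mathrm{T}})T$, $$QL_i=G_{1i}Q\quad\text{and}\quad H=MQ$$ hold for each $i=1,2,\dots,2^m$; (iv) there exists a permutation matrix $T\in\mathcal{L}_{2^n\times 2^n}$ such that, with $Q=(I_{2^s}\otimes \mathbf{1}_{2^{n-s}}^{\mathrm{T}})T$, the matrices $$\tfrac{1}{2^{n-s}}\,QL_iQ^{\mathrm{T}}\ (i=1,2,\dots,2^m)\quad\text{and}\quad \tfrac{1}{2^{n-s}}\,HQ^{\mathrm{T}}$$ are logical matrices.
   Context: Notation: $\delta_k^i$ is the $i$-th column of the identity matrix $I_k$, $\Delta_k=\{\delta_k^1,\dots,\delta_k^k\}$. A real $a\times b$ matrix is a logical matrix if every column lies in $\Delta_a$; $\mathcal{L}_{a\times b}$ is the set of all $a\times b$ logical matrices. $\mathbf{1}_k$ is the all-ones column vector of length $k$; $\otimes$ is the Kronecker product. Algebraic form: let $\mathcal{D}=\{1,0\}$ (True, False), and $f_i:\mathcal{D}^{n+m}\to\mathcal{D}$, $h_i:\mathcal{D}^n\to\mathcal{D}$ be the logical functions of the BCN. Identify True with $\delta_2^1$ and False with $\delta_2^2$. A tuple of logical variables $(x_1,\dots,x_n)$ is identified with $x=x_1\otimes\cdots\otimes x_n\in\Delta_{2^n}$ (a bijection $\mathcal{D}^n\to\Delta_{2^n}$), and similarly $u=u_1\otimes\cdots\otimes u_m\in\Delta_{2^m}$, $y=y_1\otimes\cdots\otimes y_p\in\Delta_{2^p}$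 (an empty product is the scalar $1$). Then there are unique logical matrices $L\in\mathcal{L}_{2^n\times 2^{n+m}}$, $H\in\mathcal{L}_{2^p\times 2^n}$ such that the BCN reads $x(t+1)=L(u(t)\otimes x(t))$, written $Lu(t)x(t)$, and $y(t)=Hx(t)$. Equivalently, if $u(t)=\delta_{2^m}^j$ then $x(t+1)=L_jx(t)$. Decomposability: a logical coordinate transformation is a bijection $\mathcal{D}^n\to\mathcal{D}^n$, $(x_1,\dots,x_n)\mapsto(z_1,\dots,z_n)$; in algebraic form it is $z=Tx$ with $T\in\mathcal{L}_{2^n\times 2^n}$ a permutation matrix. The BCN is decomposable with respect to outputs of (with) order $n-s$ if there is a logical coordinate transformation under which it takes the form $z_i(t+1)=\hat f_i(z_1(t),\dots,z_s(t),u_1(t),\dots,u_m(t))$ for $1\le i\le s$; $z_i(t+1)=\hat f_i(z_1(t),\dots,z_n(t),u_1(t),\dots,u_m(t))$ for $s+1\le i\le n$; $y_i(t)=\hat h_i(z_1(t),\dots,z_s(t))$ for $1\le i\le p$, with logical functions $\hat f_i,\hat h_i$. (That is, the next values of $z_1,\dots,z_s$ and the outputs do not depend on $z_{s+1},\dots,z_n$.) *)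

(* Defs.v *)
(* The Kronecker product [A *t B] is [tensmx] of mxtens. *)
From mathcomp Require Import all_boot all_order all_algebra.
From mathcomp Require Export mxtens.

Set Implicit Arguments.
Unset Strict Implicit.
Unset Printing Implicit Defensive.

Import GRing.Theory Num.Theory.
Local Open Scope ring_scope.

(* [true] is True (= 1), [false] is False (= 0). *)
Notation bvec n := {ffun 'I_n -> bool}.

Definition bvec_prefix n s (hs : (s <= n)%N) (z : bvec n) : bvec s :=
  [ffun i => z (widen_ord hs i)].

Record bcn (n m p : nat) := BCN {
  bcn_f : 'I_n -> bvec n -> bvec m -> bool;
  bcn_h : 'I_p -> bvec n -> bool }.

Definition bcn_next n m p (S : bcn n m p) (x : bvec n) (u : bvec m) : bvec n :=
  [ffun i => bcn_f S i x u].

Definition bcn_out n m p (S : bcn n m p) (x : bvec n) : bvec p :=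
  [ffun i => bcn_h S i x].

(* The order of decomposability is n - s.  Since x(t) and u(t) are arbitrary,
   the transformed equations for z = phi(x) are required at every state and
   every input.  The second clause imposes no restriction on the BCN (phi is a
   bijection); it is part of the prescribed form. *)
Definition decomposable n m p (S : bcn n m p) s (hs : (s <= n)%N) : Prop :=
  exists (phi : bvec n -> bvec n)
         (f1 : 'I_s -> bvec s -> bvec m -> bool)
         (f2 : 'I_n -> bvec n -> bvec m -> bool)
         (h1 : 'I_p -> bvec s -> bool),
    bijective phi /\
    forall (x : bvec n) (u : bvec m),
      [/\ forall i : 'I_s, phi (bcn_next S x u) (widen_ord hs i)
                           = f1 i (bvec_prefix hs (phi x)) u,
          forall i : 'I_n, (s <= i)%N -> phi (bcn_next S x u) i = f2 i (phi x) u
        & forall i : 'I_p, bcn_out S x i = h1 i (bvec_prefix hs (phi x))].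

Lemma exp2_mul a b c : (a + b = c)%N -> (2 ^ a * 2 ^ b = 2 ^ c)%N.
Proof. by move<-; rewrite expnD. Qed.

Lemma subnKC_add m n s : (s <= n)%N -> ((m + s) + (n - s) = n + m)%N.
Proof. by move=> hs; rewrite -addnA subnKC // addnC. Qed.

Section Matrices.
Variable R : realFieldType.

Definition delta k (i : 'I_k) : 'cV[R]_k := col i 1%:M.

Definition logical_mx a b (A : 'M[R]_(a, b)) : Prop :=
  forall j : 'I_b, exists i : 'I_a, col j A = delta i.

Definition ones k : 'cV[R]_k := const_mx 1.

(* True is delta_2^1 and False is delta_2^2 (ordinals count from 0). *)
Definition bool_vec (b : bool) : 'cV[R]_2 :=
  delta (if b then ord0 else ord_max).

(* x_1 (x) ... (x) x_n, the empty product being the scalar 1. *)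
Fixpoint kron_vec n : bvec n -> 'cV[R]_(2 ^ n) :=
  match n with
  | 0 => fun _ => 1%:M
  | k.+1 => fun x =>
      castmx (esym (expnS 2 k), muln1 1)
        (bool_vec (x ord0) *t kron_vec [ffun i => x (lift ord0 i)])
  end.

(* u (x) x, with its length 2^m * 2^n read as 2^(n + m). *)
Definition kron_ux n m (u : 'cV[R]_(2 ^ m)) (x : 'cV[R]_(2 ^ n)) :
    'cV[R]_(2 ^ (n + m)) :=
  castmx (exp2_mul (addnC m n), muln1 1) (u *t x).

Definition algebraic_form n m p (S : bcn n m p)
    (L : 'M[R]_(2 ^ n, 2 ^ (n + m))) (H : 'M[R]_(2 ^ p, 2 ^ n)) : Prop :=
  [/\ logical_mx L, logical_mx H,
      forall (x : bvec n) (u : bvec m),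
        kron_vec (bcn_next S x u) = L *m kron_ux (kron_vec u) (kron_vec x)
    & forall x : bvec n, kron_vec (bcn_out S x) = H *m kron_vec x].

(* I_{2^k} (x) 1_{2^r}^T *)
Definition Ikron1T k r N (e : (k + r = N)%N) : 'M[R]_(2 ^ k, 2 ^ N) :=
  castmx (muln1 (2 ^ k)%N, exp2_mul e) ((1%:M : 'M_(2 ^ k)) *t (ones (2 ^ r))^T).

(* I_{2^k} (x) A *)
Definition Ikron k r N (e : (k + r = N)%N) (A : 'M[R]_(2 ^ r)) : 'M[R]_(2 ^ N) :=
  castmx (exp2_mul e, exp2_mul e) ((1%:M : 'M_(2 ^ k)) *t A).

(* The i-th block A_i of A = [A_0, ..., A_{2^k - 1}], each with 2^r columns:
   column c of A_i is column i * 2^r + c of A. *)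
Definition col_block a k r N (e : (k + r = N)%N) (A : 'M[R]_(a, 2 ^ N))
    (i : 'I_(2 ^ k)) : 'M[R]_(a, 2 ^ r) :=
  colsub (fun c : 'I_(2 ^ r) => cast_ord (exp2_mul e) (mxtens_index (i, c))) A.

Definition permutation_mx k (T : 'M[R]_k) : Prop :=
  logical_mx T /\ is_perm_mx T.

End Matrices.

Arguments Ikron1T R {k r N} e.

(* Main.v *)
(* A logical matrix is the matrix of a map between finite index sets, and the
   product of such matrices is the matrix of the composite.  Reading a bit
   vector as a binary number (with True as digit 0) turns x_1 (x) ... (x) x_n
   into a unit vector, under which I (x) 1^T is the map forgetting the last
   n - s bits and Q a map q all of whose fibres have 2^(n-s) elements.
   Conditions (i)-(iii) then all say that q o l_u (with l_u the map of L_u)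
   and the map h of H factor through q.  For (iv), the (a, b) entry of F Q^T,
   with F the matrix of a map f, is the number of x with f x = a and q x = b;
   if F Q^T / 2^(n-s) is the matrix of a map g, then its entry at (f x, q x)
   is nonzero, hence f x = g (q x). *)
Require Import Defs.
From mathcomp Require Import all_boot all_order all_algebra.
From mathcomp Require Import fingroup perm.

Import GRing.Theory Num.Theory.
Local Open Scope ring_scope.

Set Implicit Arguments.
Unset Strict Implicit.
Unset Printing Implicit Defensive.

(** * Bit vectors as binary numbers, and the removal of low-order bits *)

Section Indices.
Local Open Scope nat_scope.

(** The number [i * 2 ^ r + j], with [k] high bits and [r] low bits: the index order of a Kronecker
    product. *)
Definition join2 k r N (e : k + r = N) (ij : 'I_(2 ^ k) * 'I_(2 ^ r)) :
    'I_(2 ^ N) :=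
  cast_ord (exp2_mul e) (mxtens_index ij).

Definition split2 k r N (e : k + r = N) (x : 'I_(2 ^ N)) :
    'I_(2 ^ k) * 'I_(2 ^ r) :=
  mxtens_unindex (cast_ord (esym (exp2_mul e)) x).

Lemma join2K k r N (e : k + r = N) : cancel (join2 e) (split2 e).
Proof. by move=> ij; rewrite /split2 /join2 cast_ordK mxtens_indexK. Qed.

Lemma split2K k r N (e : k + r = N) : cancel (split2 e) (join2 e).
Proof. by move=> x; rewrite /split2 /join2 mxtens_unindexK cast_ordKV. Qed.

Lemma divn_exp2MDl b s r n a : s + r = n ->
  (b * 2 ^ n + a) %/ 2 ^ r = b * 2 ^ s + a %/ 2 ^ r.
Proof. by move=> <-; rewrite expnD mulnA divnMDl ?expn_gt0. Qed.

(** Since [2 ^ r] divides [2 ^ n], cutting low bits does not touch the leading block [u]. This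
    relates the two factors I (x) 1^T of (ii), with 2^s and 2^(m+s) rows. *)
Lemma split2_join2_assoc m s r n N (e : s + r = n) (em : m + n = N)
    (e' : (m + s) + r = N) u z :
  (split2 e' (join2 em (u, z))).1 = join2 erefl (u, (split2 e z).1).
Proof.
by apply: val_inj => /=; exact: divn_exp2MDl.
Qed.

Lemma card_split2_fiber k r N (e : k + r = N) (b : 'I_(2 ^ k)) :
  #|[set z | (split2 e z).1 == b]| = 2 ^ r.
Proof.
have injb : injective (fun c : 'I_(2 ^ r) => join2 e (b, c)).
  by move=> c d /(can_inj (join2K e)) [].
rewrite -[RHS]card_ord -(card_imset _ injb).
apply: eq_card => z; rewrite inE; apply/eqP/imsetP => [<-|[c _ ->]].
  by exists (split2 e z).2 => //; rewrite -surjective_pairing split2K.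
by rewrite join2K.
Qed.

(** The first variable is the most significant digit, so that taking a prefix becomes integer
    division. *)
Fixpoint bcode n : bvec n -> 'I_(2 ^ n) :=
  match n with
  | 0 => fun _ => ord0
  | k.+1 => fun x =>
      cast_ord (esym (expnS 2 k))
        (mxtens_index (if x ord0 then ord0 else ord_max,
                       bcode [ffun i => x (lift ord0 i)]))
  end.

Lemma val_bcodeS n (x : bvec n.+1) :
  bcode x = ~~ x ord0 * 2 ^ n + bcode [ffun i => x (lift ord0 i)] :> nat.
Proof. by rewrite /=; case: (x ord0). Qed.

Lemma bcode_inj n : injective (@bcode n).
Proof.
elim: n => [x y _|n IHn x y]; first by apply/ffunP => -[].
move/cast_ord_inj/(can_inj (@mxtens_indexK _ _)) => [].
move=> exy0 /IHn/ffunP exy.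
apply/ffunP => i; case: (unliftP ord0 i) => [j ->|->].
  by have := exy j; rewrite !ffunE.
by move: exy0; case: (x ord0); case: (y ord0).
Qed.

Lemma bcode_bij n : bijective (@bcode n).
Proof.
apply: (inj_card_bij (@bcode_inj n)).
by rewrite card_ffun card_bool !card_ord.
Qed.

(** Induction strips the leading bit from [z] and from its prefix at once, which leaves the divisor
    [2 ^ (n - s)] unchanged. *)
Lemma val_bcode_prefix n s (hs : s <= n) (z : bvec n) :
  bcode (bvec_prefix hs z) = bcode z %/ 2 ^ (n - s) :> nat.
Proof.
elim: n s hs z => [|n IHn] [|s] hs z //; first by rewrite divn_small ?subn0.
rewrite !val_bcodeS subSS ffunE.
have -> : widen_ord hs ord0 = ord0 by exact: val_inj.
rewrite (divn_exp2MDl _ _ (subnKC (hs : s <= n))) -IHn; congr (_ + bcode _).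
by apply/ffunP => i; rewrite !ffunE; congr (z _); exact: val_inj.
Qed.

Lemma bcode_prefix n s (hs : s <= n) (z : bvec n) :
  bcode (bvec_prefix hs z) = (split2 (subnKC hs) (bcode z)).1.
Proof. by apply: val_inj; exact: val_bcode_prefix. Qed.

End Indices.

(** * Logical matrices as matrices of maps *)

Section Logical.
Variable R : realFieldType.

Definition fun_mx a b (f : 'I_b -> 'I_a) : 'M[R]_(a, b) :=
  \matrix_(i, j) (i == f j)%:R.

Lemma eq_fun_mx a b (f g : 'I_b -> 'I_a) : f =1 g -> fun_mx f = fun_mx g.
Proof. by move=> fg; apply/matrixP => i j; rewrite !mxE fg. Qed.

Lemma fun_mx_inj a b (f g : 'I_b -> 'I_a) : fun_mx f = fun_mx g -> f =1 g.
Proof.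
move=> /matrixP fg j; have /eqP := fg (f j) j.
by rewrite !mxE eqxx eqr_nat; case: (f j =P g j).
Qed.

Lemma deltaE k (i : 'I_k) : delta R i = fun_mx (fun=> i).
Proof. by apply/matrixP => j z; rewrite !mxE. Qed.

Lemma fun_mx_logical a b (f : 'I_b -> 'I_a) : logical_mx (fun_mx f).
Proof. by move=> j; exists (f j); apply/matrixP => i z; rewrite !mxE. Qed.

Lemma logical_mxP a b (A : 'M[R]_(a, b)) :
  logical_mx A -> exists f, A = fun_mx f.
Proof.
move=> /fin_all_exists[f Af]; exists f; apply/matrixP => i j.
by have /matrixP/(_ i ord0) := Af j; rewrite !mxE.
Qed.

Lemma mul_fun_mx a b c (f : 'I_b -> 'I_a) (g : 'I_c -> 'I_b) :
  fun_mx f *m fun_mx g = fun_mx (f \o g).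
Proof.
apply/matrixP => i j; rewrite !mxE (bigD1 (g j)) //= big1 ?addr0.
  by rewrite !mxE eqxx mulr1.
by move=> k /negPf nk; rewrite !mxE nk mulr0.
Qed.

Lemma permutation_fun_mx k (t : 'S_k) : permutation_mx (fun_mx t).
Proof.
split; first exact: fun_mx_logical.
(* [perm_mx] puts the 1 of row [i] in column [s i], whereas [fun_mx] works by columns; hence the
   inverse. *)
apply/is_perm_mxP; exists t^-1%g; apply/matrixP => i j; rewrite !mxE.
by rewrite -(inj_eq (@perm_inj _ t) (t^-1%g i)) permKV.
Qed.

Lemma permutation_mxP k (T : 'M[R]_k) :
  permutation_mx T -> exists t : 'S_k, T = fun_mx t.
Proof.
case=> _ /is_perm_mxP[s ->]; exists s^-1%g; apply/matrixP => i j; rewrite !mxE.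
by rewrite -(inj_eq (@perm_inj _ s) i) permKV.
Qed.

Lemma tr_fun_perm_mx k (t : 'S_k) : (fun_mx t)^T = fun_mx t^-1%g.
Proof.
apply/matrixP => i j; rewrite !mxE.
by rewrite -(inj_eq (@perm_inj _ t) i) permKV eq_sym.
Qed.

Lemma Ikron1TE k r N (e : (k + r = N)%N) :
  Ikron1T R e = fun_mx (fun z => (split2 e z).1).
Proof.
apply/matrixP => i j; rewrite castmxE !mxE mulr1; congr (_ == _)%:R.
by apply: val_inj; rewrite /= divn1.
Qed.

Lemma Ikron_fun_mx k r N (e : (k + r = N)%N) (f : 'I_(2 ^ r) -> 'I_(2 ^ r)) :
  Ikron e (fun_mx f)
  = fun_mx (fun z => join2 e ((split2 e z).1, f (split2 e z).2)).
Proof.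
apply/matrixP => i j; rewrite castmxE !mxE -natrM mulnb; congr (nat_of_bool _)%:R.
rewrite -(can_eq (split2K e)) join2K.
by rewrite [split2 e i]surjective_pairing xpair_eqE.
Qed.

Lemma kron_ux_delta n m (i : 'I_(2 ^ m)) (j : 'I_(2 ^ n)) :
  kron_ux (delta R i) (delta R j) = delta R (join2 (addnC m n) (i, j)).
Proof.
rewrite !deltaE; apply/matrixP => a b.
rewrite castmxE !mxE -natrM mulnb; congr (nat_of_bool _)%:R.
by rewrite -(can_eq (split2K (addnC m n))) join2K [split2 _ a]surjective_pairing.
Qed.

Lemma kron_vecE n (x : bvec n) : kron_vec R x = delta R (bcode x).
Proof.
elim: n x => [|n IHn] x /=.
  by apply/matrixP => i j; rewrite !mxE !ord1.
rewrite IHn /bool_vec !deltaE; apply/matrixP => a b.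
rewrite castmxE !mxE -natrM mulnb; congr (nat_of_bool _)%:R.
rewrite esymK -(inj_eq (@cast_ord_inj _ _ (expnS 2 n)) a) cast_ordKV.
by rewrite -(can_eq (@mxtens_unindexK _ _)) mxtens_indexK.
Qed.

Lemma delta_inj k : injective (@delta R k).
Proof.
move=> i j; rewrite !deltaE => /fun_mx_inj; apply.
exact: (ord0 : 'I_1).
Qed.

Lemma fun_mx_delta a b (f : 'I_b -> 'I_a) j :
  fun_mx f *m delta R j = delta R (f j).
Proof. by rewrite !deltaE mul_fun_mx. Qed.

Lemma col_block_fun_mx a k r N (e : (k + r = N)%N) (f : 'I_(2 ^ N) -> 'I_a) i :
  col_block e (fun_mx f) i = fun_mx (fun c => f (join2 e (i, c))).
Proof. by apply/matrixP => c d; rewrite !mxE. Qed.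

Lemma mul_fun_mx_trE a b c (f : 'I_c -> 'I_a) (q : 'I_c -> 'I_b) i j :
  (fun_mx f *m (fun_mx q)^T) i j = #|[set x | (i == f x) && (j == q x)]|%:R.
Proof.
rewrite mxE cardE -sum1_size big_enum natr_sum [RHS]big_mkcond.
by apply: eq_bigr => x _; rewrite !mxE inE; case: (i == _); case: (j == _);
  rewrite ?mulr0 ?mulr1.
Qed.

Lemma logical_fun_mx_tr_factor a b c N (f : 'I_c -> 'I_a) (q : 'I_c -> 'I_b) :
  (0 < N)%N ->
  logical_mx (N%:R^-1 *: (fun_mx f *m (fun_mx q)^T)) ->
  exists g : 'I_b -> 'I_a, forall x, f x = g (q x).
Proof.
move=> N0 /logical_mxP[g /matrixP fq]; exists g => x.
have := fq (f x) (q x); rewrite mxE mul_fun_mx_trE mxE.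
case: eqP => // _ /eqP; rewrite mulf_eq0 invr_eq0 !pnatr_eq0 -leqn0 leqNgt N0 /=.
by rewrite cards_eq0 => /eqP/setP/(_ x); rewrite !inE !eqxx.
Qed.

(** Distinct fibres of [q] are disjoint and each has [N] elements, so Q Q^T = N I, and G Q Q^T / N =
    G. *)
Lemma factor_fun_mx_tr a b c N (g : 'I_b -> 'I_a) (q : 'I_c -> 'I_b) :
  (0 < N)%N -> (forall j, #|[set x | q x == j]| = N) ->
  N%:R^-1 *: (fun_mx (g \o q) *m (fun_mx q)^T) = fun_mx g.
Proof.
move=> N0 cardq; rewrite -mul_fun_mx -mulmxA.
suff -> : fun_mx q *m (fun_mx q)^T = N%:R%:M.
  by rewrite mul_mx_scalar scalerA mulVf ?scale1r // pnatr_eq0 -lt0n.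
apply/matrixP => i j; rewrite mul_fun_mx_trE mxE.
have [->|/negPf ij] := eqVneq i j.
  by rewrite mulr1n -(cardq j); congr (_%:R); apply: eq_card => x;
    rewrite !inE andbb eq_sym.
rewrite mulr0n; apply/eqP; rewrite pnatr_eq0 cards_eq0; apply/eqP/setP => x.
by rewrite !inE; apply/negP => /andP[/eqP ix /eqP jx]; rewrite ix jx eqxx in ij.
Qed.

(** Precomposing with a bijection preserves fibre sizes; this count is the normalising factor in
    (iv). *)
Lemma card_split2_perm_fiber k r N (e : (k + r = N)%N) (t : 'S_(2 ^ N)) b :
  #|[set x | (split2 e (t x)).1 == b]| = (2 ^ r)%N.
Proof.
rewrite -[RHS](card_split2_fiber e b) -[RHS](card_preimset _ (@perm_inj _ t)).
by apply: eq_card => x; rewrite !inE.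
Qed.

End Logical.

(* Otherwise simplification unfolds [(split2 e z).1] to a raw ordinal. *)
Local Opaque join2 split2.

Theorem theorem1 (R : realFieldType) (n m p : nat) (S : bcn n m p)
  (L : 'M[R]_(2 ^ n, 2 ^ (n + m))) (H : 'M[R]_(2 ^ p, 2 ^ n))
  (hLH : algebraic_form S L H) (s : nat) (hs : (s <= n)%N) :
  let Lb := col_block (addnC m n) L in
  let Q := fun T : 'M[R]_(2 ^ n) => Ikron1T R (subnKC hs) *m T in
  [<->
    (* (i) *)
    decomposable S hs;
    (* (ii) *)
    exists (T : 'M[R]_(2 ^ n)) (G1 : 'M[R]_(2 ^ s, 2 ^ (m + s)))
           (M : 'M[R]_(2 ^ p, 2 ^ s)),
      [/\ permutation_mx T, logical_mx G1, logical_mx M,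
          Ikron1T R (subnKC hs) *m T *m L *m Ikron (addnC m n) T^T
            = G1 *m Ikron1T R (subnKC_add m hs)
        & H *m T^T = M *m Ikron1T R (subnKC hs)];
    (* (iii) *)
    exists (T : 'M[R]_(2 ^ n)) (G1 : 'M[R]_(2 ^ s, 2 ^ (m + s)))
           (M : 'M[R]_(2 ^ p, 2 ^ s)),
      [/\ permutation_mx T, logical_mx G1, logical_mx M
        & forall i : 'I_(2 ^ m),
            Q T *m Lb i = col_block (erefl (m + s)%N) G1 i *m Q T
            /\ H = M *m Q T];
    (* (iv) *)
    exists T : 'M[R]_(2 ^ n),
      [/\ permutation_mx T,
          forall i : 'I_(2 ^ m),
            logical_mx ((2 ^ (n - s))%:R^-1 *: (Q T *m Lb i *m (Q T)^T))
        & logical_mx ((2 ^ (n - s))%:R^-1 *: (H *m (Q T)^T))]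
  ].
Proof.
have [/logical_mxP[l eL] /logical_mxP[h eH] nextE outE] := hLH.
(* Unit vectors determine their indices, so the dynamics and outputs become equations for the index
   maps [l] and [h]. *)
have {nextE} nextE x u :
    bcode (bcn_next S x u) = l (join2 (addnC m n) (bcode u, bcode x)).
  apply: (@delta_inj R).
  by rewrite -!kron_vecE nextE !kron_vecE kron_ux_delta eL fun_mx_delta.
have {outE} outE x : bcode (bcn_out S x) = h (bcode x).
  by apply: (@delta_inj R); rewrite -!kron_vecE outE kron_vecE eH fun_mx_delta.
move=> Lb Q; rewrite {}/Lb {}/Q eL eH {L H hLH eL eH}.
pose q (t : 'S_(2 ^ n)) x := (split2 (subnKC hs) (t x)).1.
have QE (t : 'S_(2 ^ n)) : Ikron1T R (subnKC hs) *m fun_mx R t = fun_mx R (q t).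
  by rewrite Ikron1TE mul_fun_mx.
have [decn bcodenK decnK] := bcode_bij n.
have [decs bcodesK _] := bcode_bij s.
have [decm bcodemK decmK] := bcode_bij m.
have [decp bcodepK _] := bcode_bij p.
tfae.
- case=> phi [f1 [f2 [h1 [phi_bij decomp]]]].
  (* The coordinate change [phi], conjugated by the binary code, is the permutation behind T. *)
  have t_inj : injective (bcode (n:=n) \o phi \o decn).
    by apply: inj_comp (can_inj decnK); apply: inj_comp (bij_inj phi_bij);
      exact: bcode_inj.
  pose t := perm t_inj.
  have tE x : t (bcode x) = bcode (phi x) by rewrite permE /= bcodenK.
  pose g a v := bcode [ffun i => f1 i (decs v) (decm a)].
  pose M v := bcode [ffun i => h1 i (decs v)].
  have gE a z : (split2 (subnKC hs) (t (l (join2 (addnC m n) (a, t^-1%g z))))).1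
                = g a (split2 (subnKC hs) z).1.
    (* Here [x] is the state whose transformed code is [z]. *)
    rewrite -[z](permKV t) permK -[t^-1%g z]decnK; set x := decn _.
    rewrite -[a]decmK -nextE !tE -!bcode_prefix /g bcodesK bcodemK; congr bcode.
    apply/ffunP => i; rewrite !ffunE.
    by have [/(_ i)-> _ _] := decomp x (decm a).
  have ME z : h (t^-1%g z) = M (split2 (subnKC hs) z).1.
    rewrite -[z](permKV t) permK -[t^-1%g z]decnK; set x := decn _.
    rewrite -outE !tE -!bcode_prefix /M bcodesK; congr bcode.
    apply/ffunP => i; rewrite [RHS]ffunE.
    (* The output equation is stated for every input; the all-true one is picked. *)
    by have [_ _ ->] := decomp x [ffun=> true].
  exists (fun_mx R t).
  exists (fun_mx R (fun c => g (split2 erefl c).1 (split2 erefl c).2)).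
  exists (fun_mx R M); split; rewrite ?tr_fun_perm_mx ?Ikron_fun_mx ?Ikron1TE.
  + exact: permutation_fun_mx.
  + exact: fun_mx_logical.
  + exact: fun_mx_logical.
  + rewrite !mul_fun_mx; apply: eq_fun_mx => c.
    rewrite -[c](split2K (addnC m n)); case: (split2 _ c) => a z /=.
    by rewrite (split2_join2_assoc (subnKC hs)) !join2K gE.
  + by rewrite !mul_fun_mx; apply: eq_fun_mx.
- case=> T [G1 [M [permT G1log Mlog]]].
  have [t ->] := permutation_mxP permT.
  have [g ->] := logical_mxP G1log; have [mu ->] := logical_mxP Mlog.
  rewrite tr_fun_perm_mx Ikron_fun_mx QE !Ikron1TE !mul_fun_mx.
  move=> /fun_mx_inj gE /fun_mx_inj ME.
  exists (fun_mx R t), (fun_mx R g), (fun_mx R mu).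
  split; [exact: permutation_fun_mx|exact: fun_mx_logical|
          exact: fun_mx_logical|move=> i].
  rewrite !col_block_fun_mx !mul_fun_mx; split; apply: eq_fun_mx => x /=.
    (* Evaluating (ii) at column [(i, t x)] undoes the factor T^T. *)
    have := gE (join2 (addnC m n) (i, t x)).
    by rewrite /= join2K permK (split2_join2_assoc (subnKC hs)).
  by have := ME (t x); rewrite /= permK.
- case=> T [G1 [M [permT /logical_mxP[g ->] /logical_mxP[mu ->]]]].
  have [t ->] := permutation_mxP permT.
  rewrite QE => GM; exists (fun_mx R t); rewrite QE.
  have N0 : (0 < 2 ^ (n - s))%N by rewrite expn_gt0.
  have cardq := card_split2_perm_fiber (subnKC hs) t.
  split=> [|i|]; first exact: permutation_fun_mx.
    have [-> _] := GM i; rewrite col_block_fun_mx mul_fun_mx factor_fun_mx_tr //.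
    exact: fun_mx_logical.
  (* H = MQ is stated for each block, so some block index has to be supplied. *)
  have [_ ->] := GM (bcode [ffun=> true]).
  by rewrite mul_fun_mx factor_fun_mx_tr //; exact: fun_mx_logical.
- case=> T [/permutation_mxP[t ->]]; rewrite QE => Llog Hlog.
  have N0 : (0 < 2 ^ (n - s))%N by rewrite expn_gt0.
  have [mu muE] := logical_fun_mx_tr_factor N0 Hlog.
  (* Each input [a] gives its own factorisation through [q t]; finiteness collects them into one
     [g]. *)
  have /fin_all_exists[g gE] a : exists g : 'I_(2 ^ s) -> 'I_(2 ^ s),
      forall x, q t (l (join2 (addnC m n) (a, x))) = g (q t x).
    have := Llog a; rewrite col_block_fun_mx mul_fun_mx.
    exact: logical_fun_mx_tr_factor.
  pose phi x := decn (t (bcode x)).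
  pose phi' x := decn (t^-1%g (bcode x)).
  have phiK : cancel phi phi'.
    by move=> x; rewrite /phi /phi' decnK permK bcodenK.
  have phiE x : bcode (bvec_prefix hs (phi x)) = q t (bcode x).
    by rewrite bcode_prefix decnK.
  (* The first [s] updates and the outputs decode [g] and [mu]; the remaining updates pull [z] back
     along [phi'], apply the BCN and return by [phi]. *)
  exists phi, (fun i z u => decs (g (bcode u) (bcode z)) i),
    (fun i z u => phi (bcn_next S (phi' z) u) i),
    (fun i z => decp (mu (bcode z)) i); split.
    by exists phi' => // x; rewrite /phi /phi' decnK permKV bcodenK.
  move=> x u; split=> [i|i _|i].
  + by rewrite phiE -gE -nextE -phiE bcodesK ffunE.
  + by rewrite phiK.
  + by rewrite phiE -muE -outE bcodepK.
Qed.
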